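(* Fix constants $0<\alpha<1$ and $K_0>0$, and let $\varepsilon,\varepsilon_1>0$ be arbitrary constants. Then there exists a constant $C=C(\varepsilon,\varepsilon_1)$ such that the following holds for all sufficiently large $r$ and $\kappa$. Let $\mathcal{H}$ be a hypergraph on a finite vertex set $X$ which is $\kappa$-spread, $r$-uniform and edge transitive, and which satisfies $$f_{t,A}\le \left(\frac{K_0}{\kappa}\right)^t|\mathcal{H}|\quad\text{for all }A\in\mathcal{H}\text{ and all integers }1\le t\le \alpha r.$$ Let each element of $X$ be colored independently and uniformly at random from $Q=[q]$, where $q\ge (1+\varepsilon_1)r$, and let $X_m^*$ denote a uniformly random $m$-subset of $X$ (chosen independently of the coloring) together with its colors. Then $$m\ge \frac{C|X|}{\kappa}\ \text{ implies }\ \mathbb{P}\big(X_m^*\text{ contains a rainbow colored edge of }\mathcal{H}\big)\ge 1-\varepsilon.$$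
   Context: A hypergraph $\mathcal{H}=\{A_1,\dots,A_M\}$ on vertex set $X$ is a family of subsets of $X$. For $S\subseteq X$, let $\langle S\rangle=\{T: S\subseteq T\subseteq X\}$. $\mathcal{H}$ is $\kappa$-spread if $|\mathcal{H}\cap\langle S\rangle|\le |\mathcal{H}|/\kappa^{|S|}$ for all $S\subseteq X$. $\mathcal{H}$ is $r$-uniform if $|A|=r$ for all $A\in\mathcal{H}$. $\mathcal{H}$ is edge transitive if for every pair of edges $A_i,A_j$ there is a permutation $\pi:X\to X$ with $\pi(A_i)=A_j$ and $\pi(A)\in\mathcal{H}$ for all $A\in\mathcal{H}$. For $A\in\mathcal{H}$ and integer $t$, $f_{t,A}=|\{B\in\mathcal{H}: |B\cap A|=t\}|$. A set of colored elements is rainbow colored if all its elements receive distinct colors. The constants $\alpha,K_0$ do not depend on $r$. *)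

(* Defs.v *)
From HB Require Import structures.
From mathcomp Require Import all_boot all_order all_algebra all_fingroup.
From mathcomp Require Import reals.

Set Implicit Arguments.
Unset Strict Implicit.
Unset Printing Implicit Defensive.

Import Order.TTheory GRing.Theory Num.Theory.

Local Open Scope ring_scope.

Section Hypergraph.

Variable X : finType.
Implicit Types (H : {set {set X}}) (A B S T : {set X}).

Definition upset S : {set {set X}} := [set T : {set X} | S \subset T].

Definition spread (R : realType) (kappa : R) H : Prop :=
  forall S, #|H :&: upset S|%:R <= #|H|%:R / kappa ^+ #|S|.

Definition uniform (r : nat) H : Prop := {in H, forall A : {set X}, #|A| = r}.

Definition edge_transitive H : Prop :=
  {in H &, forall A B : {set X}, exists pi : {perm X},
     pi @: A = B /\ (forall E : {set X}, E \in H -> pi @: E \in H)}.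

Definition inter_count H (t : nat) A : nat :=
  #|[set B : {set X} in H | #|B :&: A| == t]|.

Definition rainbow (q : nat) (c : {ffun X -> 'I_q}) A : bool :=
  [forall x in A, forall y in A, (x != y) ==> (c x != c y)].

(* The random coloured set is a pair w = (W, c): W is the random vertex subset
   and c a colouring of all of X. Counting measure on the product of the
   m-subsets with the colourings makes W a uniform m-subset, the colours of the
   elements of X i.i.d. uniform on 'I_q, and W independent of c. *)
Definition colored_subsets (q m : nat) :
    {set {set X} * {ffun X -> 'I_q}} :=
  [set w : {set X} * {ffun X -> 'I_q} | #|w.1| == m].

Definition has_rainbow_edge H (q : nat)
    (w : {set X} * {ffun X -> 'I_q}) : bool :=
  [exists A : {set X} in H, (A \subset w.1) && rainbow w.2 A].

End Hypergraph.

(* Probability of E under the uniform distribution on Omega; meaningful only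
   for nonempty Omega, since 0 / 0 = 0. *)
Definition unif_prob (R : realType) (T : finType) (Omega : {set T})
    (E : pred T) : R :=
  #|[set w in Omega | E w]|%:R / #|Omega|%:R.

(* Main.v *)
(** Second moment method for the number Z of rainbow edges inside the random set.
    The overlap hypothesis only concerns [t <= alpha r]; for larger [t], being
    spread gives [f_t <= 2^r |H| / kappa^t], and [2^r <= (2^(1/alpha))^t], so that
    [f_t <= (K1/kappa)^t |H|] for all [t >= 1].  If [|A :&: B| = t], then the
    joint probability that [A] and [B] both are rainbow and covered exceeds the
    product of their probabilities by a factor at most
    [(2n/m)^t ((1+eps1)/eps1)^t], hence [E Z^2 / (E Z)^2] is at most a geometric
    series whose ratio is O(1/C). *)

Require Import Defs.
From HB Require Import structures.
From mathcomp Require Import all_boot all_order all_algebra all_fingroup.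
From mathcomp Require Import reals.
From mathcomp Require Import ring lra zify.

Set Implicit Arguments.
Unset Strict Implicit.
Unset Printing Implicit Defensive.

Import Order.TTheory GRing.Theory Num.Theory.

Local Open Scope ring_scope.

(** * Chebyshev's inequality for uniform counting *)

Lemma natr_card_pred (R : realType) (T : finType) (Omega : {set T}) (E : pred T) :
  #|[set w in Omega | E w]|%:R = \sum_(w in Omega) (E w)%:R :> R.
Proof.
rewrite -sum1_card natr_sum [RHS]big_mkcond [LHS]big_mkcond /=.
by apply: eq_bigr => w _; rewrite inE; case: (w \in Omega); case: (E w).
Qed.

(** Chebyshev's inequality in counting form: the variance of [Z] is at most [eps * mu ^+ 2], so [Z]
    vanishes with probability at most [eps]. *)
Lemma second_moment (R : realType) (T : finType) (Omega : {set T})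
    (Z : T -> R) (E : pred T) (mu eps : R) :
    (forall w, ~~ E w -> Z w = 0) -> 0 < mu -> Omega != set0 ->
    \sum_(w in Omega) Z w = mu * #|Omega|%:R ->
    \sum_(w in Omega) Z w ^+ 2 <= (1 + eps) * mu ^+ 2 * #|Omega|%:R ->
  1 - eps <= unif_prob R Omega E.
Proof.
move=> Z0 mu_gt0 Omega_n0 Z1 Z2.
have N_gt0 : 0 < #|Omega|%:R :> R by rewrite ltr0n card_gt0.
rewrite /unif_prob ler_pdivlMr //.
pose a := mu^-1.
have amu : a * mu = 1 by rewrite mulVf ?gt_eqF.
have a2_ge0 : 0 <= a ^+ 2 by apply: sqr_ge0.
rewrite natr_card_pred.
(* Pointwise, the indicator of [E] is at least [1 - (1 - a * Z w) ^+ 2]. *)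
apply: (@le_trans _ _ (\sum_(w in Omega) (a * Z w *+ 2 - a ^+ 2 * Z w ^+ 2))).
  rewrite sumrB sumrMnl -!mulr_sumr Z1.
  have : a ^+ 2 * \sum_(w in Omega) Z w ^+ 2 <= (1 + eps) * #|Omega|%:R.
    apply: le_trans (ler_wpM2l a2_ge0 Z2) _.
    have -> : a ^+ 2 * ((1 + eps) * mu ^+ 2 * #|Omega|%:R)
      = (a * mu) ^+ 2 * ((1 + eps) * #|Omega|%:R) by ring.
    by rewrite amu expr1n mul1r.
  rewrite mulrA amu; lra.
apply: ler_sum => w _; case: (boolP (E w)) => [_ | /Z0 ->] /=; last first.
  by rewrite mulr0 mul0rn expr0n mulr0 subr0.
have := sqr_ge0 (1 - a * Z w); nra.
Qed.

(** * Exact counts of covering sets and of rainbow colourings *)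

Section Counting.

Variable X : finType.
Implicit Types (A B D S W : {set X}).

Lemma card_supsets_of_card (m : nat) S : (#|S| <= m)%N ->
  #|[set W : {set X} | (#|W| == m) && (S \subset W)]| = 'C(#|X| - #|S|, m - #|S|).
Proof.
move=> le_Sm; have -> : (#|X| - #|S|)%N = #|~: S| by rewrite [in RHS]cardsCs setCK.
rewrite -cards_draws.
have inj : {in [set B : {set X} | (B \subset ~: S) & #|B| == (m - #|S|)%N] &,
    injective (fun B => S :|: B)}.
  move=> B1 B2; rewrite !inE => /andP[/setIidPl d1 _] /andP[/setIidPl d2 _].
  by move=> /(congr1 (fun B => B :&: ~: S)); rewrite !setIUl setICr !set0U d1 d2.
rewrite -(card_in_imset inj); apply: eq_card => W; rewrite !inE.
apply/andP/imsetP => [[/eqP cW sW] | [B]].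
  exists (W :\: S); last by rewrite -[X in X :|: _](setIidPr sW) setID.
  by rewrite inE subsetDr /= cardsD (setIidPr sW) cW.
rewrite inE => /andP[dB /eqP cB] ->; split; last exact: subsetUl.
rewrite cardsU (_ : S :&: B = set0) ?cards0 ?subn0 ?cB ?subnKC //.
by apply/eqP; rewrite setI_eq0 disjoint_sym disjoints_subset.
Qed.

(* Swapping [c x] with [v] is an involution on the pairs [(c, v)]; it trades
   "[v] is allowed" for "[c x] is allowed". *)
Lemma card_avoid_color (q k : nat) (x : X) (P : pred {ffun X -> 'I_q})
    (F : {ffun X -> 'I_q} -> {set 'I_q}) :
    (forall c c' : {ffun X -> 'I_q}, (forall y, y != x -> c y = c' y) ->
       P c = P c' /\ F c = F c') ->
    (forall c, P c -> #|F c| = k) ->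
  (#|[set c | P c & c x \notin F c]| * q = #|[set c | P c]| * (q - k))%N.
Proof.
move=> loc cardF.
pose upd (c : {ffun X -> 'I_q}) v := [ffun y => if y == x then v else c y].
pose sw (w : {ffun X -> 'I_q} * 'I_q) := (upd w.1 w.2, w.1 x).
have updP c v : P c = P (upd c v) /\ F c = F (upd c v).
  by apply: loc => y /negbTE yx; rewrite ffunE yx.
have swK : involutive sw.
  move=> [c v]; rewrite /sw /=; congr (_, _); last by rewrite ffunE eqxx.
  by apply/ffunP => y; rewrite !ffunE; case: eqP => [->|].
have -> : (#|[set c | P c & c x \notin F c]| * q
    = #|[set w : {ffun X -> 'I_q} * 'I_q | P w.1 & w.1 x \notin F w.1]|)%N.
  rewrite -[X in (_ * X)%N]card_ord -[X in (_ * X)%N]cardsT -cardsX.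
  by apply: eq_card => w; rewrite !inE andbT.
rewrite -(card_imset _ (inv_inj swK)).
have -> : sw @: [set w | P w.1 & w.1 x \notin F w.1]
    = [set w | P w.1 & w.2 \notin F w.1].
  apply/setP => w; rewrite -[w in LHS]swK (mem_imset _ _ (inv_inj swK)) !inE /=.
  by have [<- <-] := updP w.1 w.2; rewrite ffunE eqxx.
rewrite -sum1_card (eq_bigl (fun w => P w.1 && (w.2 \notin F w.1))); last first.
  by move=> w; rewrite inE.
rewrite -(pair_big_dep P (fun c v => v \notin F c) (fun _ _ => 1%N)) /=.
rewrite (eq_bigr (fun _ => (q - k)%N)) => [|c Pc].
  by rewrite sum_nat_const cardsE.
have := cardC (mem (F c)); rewrite card_ord (cardF _ Pc) => qE.
by rewrite sum1_card -[q in RHS]qE addKn; apply: eq_card => v; rewrite !inE.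
Qed.

Lemma rainbow_injP (q : nat) (c : {ffun X -> 'I_q}) A :
  reflect {in A &, injective c} (rainbow c A).
Proof.
apply: (iffP forallP) => [rb x y Ax Ay eqc | inj x].
  have /implyP/(_ Ax)/forallP/(_ y)/implyP/(_ Ay)/implyP := rb x.
  by rewrite eqc eqxx; case: eqP => // _ /(_ isT).
apply/implyP => Ax; apply/forallP => y; apply/implyP => Ay.
by apply/implyP; apply: contra => /eqP /inj -> //.
Qed.

Lemma rainbowU1 (q : nat) (c : {ffun X -> 'I_q}) x A : x \notin A ->
  rainbow c (x |: A) = rainbow c A && (c x \notin c @: A).
Proof.
move=> xA; apply/rainbow_injP/andP => [inj | [/rainbow_injP inj cx] y z].
  split; first by apply/rainbow_injP => y z yA zA; apply: inj; rewrite in_setU1 ?yA ?zA orbT.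
  apply/imsetP => -[y yA cxy]; move: xA.
  by rewrite (inj x y) ?yA // in_setU1 ?eqxx ?yA ?orbT.
rewrite !in_setU1 => /predU1P[->|yA] /predU1P[->|zA] // eqc.
- by rewrite eqc imset_f in cx.
- by rewrite -eqc imset_f in cx.
- exact: inj.
Qed.

Lemma eq_in_rainbow (q : nat) (c c' : {ffun X -> 'I_q}) A :
  {in A, c =1 c'} -> rainbow c A = rainbow c' A.
Proof.
by move=> eqc; apply/rainbow_injP/rainbow_injP => inj x y xA yA;
  [rewrite -!eqc | rewrite !eqc] => //; apply: inj.
Qed.

(** The colour of [x] must avoid [c @: B]. This set does not depend on [c x], and has [#|B|]
    elements because [c] is injective on [B]. *)
Lemma card_rainbowU1 (q : nat) A B x : x \notin A -> x \notin B ->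
  (#|[set c : {ffun X -> 'I_q} | rainbow c A & rainbow c (x |: B)]| * q
   = #|[set c : {ffun X -> 'I_q} | rainbow c A & rainbow c B]| * (q - #|B|))%N.
Proof.
move=> xA xB.
rewrite -(@card_avoid_color q _ x (fun c => rainbow c A && rainbow c B)
   (fun c : {ffun X -> 'I_q} => c @: B)) => [|c c' eqc|c /andP[_ /rainbow_injP]].
- by congr (_ * _)%N; apply: eq_card => c; rewrite !inE rainbowU1 ?andbA.
- have eqS S : x \notin S -> {in S, c =1 c'}.
    by move=> xS y yS; apply: eqc; apply: contraNneq xS => <-.
  by rewrite -(eq_in_rainbow (eqS _ xA)) -(eq_in_rainbow (eqS _ xB))
    (eq_in_imset (eqS _ xB)).
- exact: card_in_imset.
Qed.

(** Induction on [#|D|], colouring one vertex of [D] after another: the next one must avoid the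
    colours of [S] and of the vertices of [D] already treated. *)
Lemma card_rainbow_disjointU (R : realType) (q : nat) A D S :
    (0 < q)%N -> [disjoint D & A] -> S \subset A ->
  #|[set c : {ffun X -> 'I_q} | rainbow c A & rainbow c (D :|: S)]|%:R
  = #|[set c : {ffun X -> 'I_q} | rainbow c A]|%:R
    * \prod_(i < #|D|) ((q - (#|S| + i))%:R / q%:R) :> R.
Proof.
move=> q_gt0; move cD: #|D| => k; elim: k D cD => [|k IHk] D cD dDA sSA.
  rewrite big_ord0 mulr1 (cards0_eq cD) set0U; congr (_%:R); apply: eq_card => c.
  rewrite !inE andb_idr // => /rainbow_injP inj; apply/rainbow_injP => x y xS yS.
  by apply: inj; apply: (subsetP sSA).
have [x xD] : exists x, x \in D by apply/set0Pn; rewrite -card_gt0 cD.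
have xA : x \notin A by rewrite (disjointFr dDA xD).
have xS : x \notin S by apply: contra xA; apply: (subsetP sSA).
have cDx : #|D :\ x| = k by move: cD; rewrite (cardsD1 x) xD => -[].
have dDx : [disjoint D :\ x & A] by apply: disjointWl dDA; apply: subD1set.
have q_neq0 : q%:R != 0 :> R by rewrite pnatr_eq0 -lt0n.
apply: (mulIf q_neq0); rewrite -natrM -[in LHS](setD1K xD) -setUA.
rewrite card_rainbowU1 ?inE ?eqxx //= natrM (IHk _ cDx dDx sSA).
have -> : #|D :\ x :|: S| = (#|S| + k)%N.
  rewrite cardsU cDx (_ : _ :&: S = set0) ?cards0 ?subn0 1?addnC //.
  by apply/eqP; rewrite setI_eq0; apply: disjointWr sSA dDx.
by rewrite big_ord_recr /= -!mulrA mulVf ?mulr1.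
Qed.

Lemma card_rainbow_pair (R : realType) (q : nat) A B : (0 < q)%N ->
  #|[set c : {ffun X -> 'I_q} | rainbow c A & rainbow c B]|%:R
  = (q ^ #|X|)%:R * \prod_(i < #|A|) ((q - i)%:R / q%:R)
    * \prod_(i < #|B :\: A|) ((q - (#|B :&: A| + i))%:R / q%:R) :> R.
Proof.
move=> q_gt0.
(* First condition on [A] being rainbow and extend from [B :&: A] to [B]. Then count the rainbow
   colourings of [A] by extending from the empty set, which every colouring makes rainbow. *)
have dBA : [disjoint B :\: A & A] by rewrite disjoints_subset subsetDr.
have := card_rainbow_disjointU R q_gt0 dBA (subsetIr B A).
have -> : B :\: A :|: B :&: A = B by rewrite setUC setID.
move=> ->; congr (_ * _).
have d0 : [disjoint A & set0 : {set X}] by rewrite disjoints_subset setC0 subsetT.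
have := card_rainbow_disjointU R q_gt0 d0 (sub0set _).
have rb0 (c : {ffun X -> 'I_q}) : rainbow c set0.
  by apply/rainbow_injP => x y; rewrite inE.
rewrite setU0 cards0 => rbA.
have -> : #|[set c : {ffun X -> 'I_q} | rainbow c A]|
    = #|[set c : {ffun X -> 'I_q} | rainbow c set0 & rainbow c A]|.
  by apply: eq_card => c; rewrite !inE rb0.
rewrite rbA; congr (_%:R * _).
have := card_ffun X 'I_q; rewrite card_ord => <-; rewrite -cardsT.
by apply: eq_card => c; rewrite !inE rb0.
Qed.

End Counting.

(** The product is the probability that [s] given vertices lie in a random [m]-subset of [n]
    vertices, revealed one at a time. *)
Lemma bin_sub_prod (R : realType) (n m s : nat) : (s <= m)%N -> (m <= n)%N ->
  'C(n - s, m - s)%:R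
  = 'C(n, m)%:R * \prod_(i < s) ((m - i)%:R / (n - i)%:R) :> R.
Proof.
move=> + le_mn; elim: s => [|s IHs] lt_sm; first by rewrite !subn0 big_ord0 mulr1.
have ns_neq0 : (n - s)%:R != 0 :> R by rewrite pnatr_eq0; lia.
rewrite big_ord_recr /= mulrA -IHs ?(ltnW lt_sm) //; apply: (mulfI ns_neq0).
have := mul_bin_diag (n - s) (m - s.+1).
have -> : (n - s).-1 = (n - s.+1)%N by lia.
have -> : (m - s.+1).+1 = (m - s)%N by lia.
by rewrite -natrM => ->; rewrite natrM; field.
Qed.

(** * Cost of an overlap of size [t] in products of conditional probabilities *)

Section Products.

Variables (R : realType) (g : nat -> R) (b : R) (r t : nat).
Hypotheses (b_ge0 : 0 <= b) (le_tr : (t <= r)%N).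

(** For the covering factors. Cancel the first [r] factors; of the second copy on the right, the
    first [r - t] factors dominate the later ones on the left, and each of the last [t] is at least
    [b]. *)
Lemma prod_overlap_antitone :
    (forall i, (i < r + r)%N -> b <= g i) ->
    (forall i j, (i <= j < r + r)%N -> g j <= g i) ->
  b ^+ t * \prod_(i < r + (r - t)) g i <= (\prod_(i < r) g i) ^+ 2.
Proof.
move=> b_le g_anti.
have g_ge0 i : (i < r + r)%N -> 0 <= g i by move=> /b_le; apply: le_trans.
have hd_ge0 k : (k <= r + r)%N -> 0 <= \prod_(i < k) g i.
  by move=> le_kr; apply: prodr_ge0 => i _; apply: g_ge0; apply: leq_trans le_kr.
rewrite big_split_ord /= mulrCA expr2; apply: ler_wpM2l; first by apply: hd_ge0; lia.
rewrite -[in leRHS](subnK le_tr) big_split_ord /= mulrC.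
apply: ler_pM; rewrite ?exprn_ge0 //.
- by apply: prodr_ge0 => i _; apply: g_ge0; have := ltn_ord i; lia.
- apply: ler_prod => i _; have lt_i := ltn_ord i.
  by rewrite g_ge0 ?g_anti //; lia.
- rewrite -[leLHS]mulr1 -[t in leLHS](card_ord t) -prodr_const mulr1.
  by apply: ler_prod => i _; rewrite b_ge0 b_le //; have := ltn_ord i; lia.
Qed.

(** For the colour factors. The second product is a tail of the full one; the missing [t] leading
    factors are each at least [b]. *)
Lemma prod_overlap_shift :
    (forall i, (i < r)%N -> b <= g i) ->
  b ^+ t * (\prod_(i < r) g i * \prod_(i < r - t) g (t + i)%N)
    <= (\prod_(i < r) g i) ^+ 2.
Proof.
move=> b_le.
have g_ge0 i : (i < r)%N -> 0 <= g i by move=> /b_le; apply: le_trans.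
rewrite mulrCA expr2; apply: ler_wpM2l; first by apply: prodr_ge0 => i _; apply: g_ge0.
rewrite -[in leRHS](subnKC le_tr) big_split_ord /=.
apply: ler_wpM2r.
  by apply: prodr_ge0 => i _; apply: g_ge0; have := ltn_ord i; lia.
rewrite -[t in leLHS](card_ord t) -prodr_const.
by apply: ler_prod => i _; rewrite b_ge0 b_le //; have := ltn_ord i; lia.
Qed.

End Products.

(** * Consequences of being spread *)

Section Spread.

Variables (R : realType) (X : finType) (H : {set {set X}}) (kappa : R).
Hypotheses (kappa_gt0 : 0 < kappa) (spreadH : spread kappa H).

(** Double counting of incidences: the spread condition on singletons bounds every degree by
    [#|H| / kappa]. *)
Lemma spread_uniform_card (r : nat) : H != set0 -> uniform r H ->
  kappa * r%:R <= #|X|%:R.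
Proof.
move=> H_n0 unifH.
have H_gt0 : 0 < #|H|%:R :> R by rewrite ltr0n card_gt0.
have degree : (#|H| * r = \sum_(x : X) #|H :&: upset [set x]|)%N.
  have -> : (#|H| * r = \sum_(A in H) \sum_(x in A) 1)%N.
    by rewrite -sum_nat_const; apply: eq_bigr => A /unifH <-; rewrite sum1_card.
  rewrite (exchange_big_dep xpredT) //=; apply: eq_bigr => x _.
  by rewrite sum1_card; apply: eq_card => A; rewrite !inE sub1set.
rewrite -(ler_pM2l H_gt0) mulrCA -natrM degree natr_sum.
rewrite -ler_pdivlMl // mulrCA.
have -> : kappa^-1 * #|X|%:R = \sum_(x : X) kappa^-1.
  by rewrite sumr_const mulr_natr.
rewrite mulr_sumr; apply: ler_sum => x _.
by have := spreadH [set x]; rewrite cards1 expr1.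
Qed.

(** Sort the edges by their trace [S] on [A]: there are [2 ^+ #|A|] candidates for [S], and each one
    of size [t] lies in at most [#|H| / kappa ^+ t] edges. *)
Lemma inter_count_le_spread (t : nat) (A : {set X}) :
  (inter_count H t A)%:R <= 2 ^+ #|A| * (#|H|%:R / kappa ^+ t).
Proof.
rewrite /inter_count -sum1_card (partition_big (fun B => B :&: A) (mem (powerset A))).
  rewrite natr_sum -natrX -card_powerset mulr_natl -sumr_const.
  apply: ler_sum => S _; rewrite sum1_card.
  have [<-|neq_tS] := eqVneq #|S| t.
    apply: le_trans (spreadH S); rewrite ler_nat; apply: subset_leq_card.
    apply/subsetP => B; rewrite !inE [in X in X -> _]unfold_in inE => /andP[/andP[-> _] /eqP <-].
    exact: subsetIl.
  rewrite eq_card0 ?divr_ge0 ?exprn_ge0 ?ler0n ?(ltW kappa_gt0) // => B.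
  rewrite unfold_in inE; apply: contraNF neq_tS.
  by move=> /andP[/andP[_ /eqP <-] /eqP ->].
by move=> B _; rewrite /= powersetE subsetIr.
Qed.

End Spread.

(** The ratio is chosen so that the infinite series sums to exactly [1 + eps]. *)
Lemma geometric_sum_le (R : realType) (eps : R) (n : nat) : 0 < eps ->
  \sum_(i < n) (eps / (1 + eps)) ^+ i <= 1 + eps.
Proof.
move=> eps_gt0; set y := eps / (1 + eps).
have y_ge0 : 0 <= y by rewrite divr_ge0 //; lra.
have yE : (1 + eps) * (1 - y) = 1 by rewrite /y; field; lra.
have y1_gt0 : 0 < 1 - y by rewrite -(pmulr_rgt0 _ (_ : 0 < 1 + eps)) ?yE //; lra.
rewrite -(ler_pM2r y1_gt0) yE mulrC -opprB mulNr -subrX1 opprB.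
by rewrite lerBlDr lerDl exprn_ge0.
Qed.

(** * First and second moments of the number of covered rainbow edges *)

Section SecondMoment.

Variables (R : realType) (X : finType) (H : {set {set X}}) (r q m : nat).
Hypotheses (unifH : uniform r H) (q_gt0 : (0 < q)%N).
Hypotheses (le_rm : (r + r <= m)%N) (le_mn : (m <= #|X|)%N).

(* Conditional probabilities, given that [i] vertices are already treated, that
   one further vertex is covered, resp. gets a new colour. *)
Let g i : R := (m - i)%:R / (#|X| - i)%:R.
Let h i : R := (q - i)%:R / q%:R.
Let rainbow_in (w : {set X} * {ffun X -> 'I_q}) (A : {set X}) :=
  (A \subset w.1) && rainbow w.2 A.

Lemma card_colored_subsets :
  #|colored_subsets X q m| = ('C(#|X|, m) * q ^ #|X|)%N.
Proof.
have -> : colored_subsets X q m = setX [set W : {set X} | #|W| == m] setT.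
  by apply/setP => w; rewrite !inE andbT.
by rewrite cardsX card_draws cardsT card_ffun card_ord.
Qed.

(** The event is a product of a condition on the vertex subset and one on the colouring. The union
    of both edges has [r + (r - #|B :&: A|)] vertices to cover. *)
Lemma card_rainbow_in_pair (A B : {set X}) : A \in H -> B \in H ->
  #|[set w in colored_subsets X q m | rainbow_in w A && rainbow_in w B]|%:R
  = #|colored_subsets X q m|%:R
    * (\prod_(i < r + (r - #|B :&: A|)) g i)
    * (\prod_(i < r) h i * \prod_(i < r - #|B :&: A|) h (#|B :&: A| + i)).
Proof.
move=> /unifH cA /unifH cB.
have cBA : #|B :\: A| = (r - #|B :&: A|)%N by rewrite cardsD cB.
have cAB : #|A :|: B| = (r + (r - #|B :&: A|))%N.
  rewrite cardsU cA cB setIC addnBA //.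
  by rewrite -cB subset_leq_card ?subsetIl.
have -> : [set w in colored_subsets X q m | rainbow_in w A && rainbow_in w B]
    = setX [set W : {set X} | (#|W| == m) && (A :|: B \subset W)]
           [set c : {ffun X -> 'I_q} | rainbow c A & rainbow c B].
  apply/setP => w; rewrite !inE subUset /rainbow_in.
  by case: (#|_| == m); rewrite //= andbACA.
have le_ABm : (#|A :|: B| <= m)%N by rewrite cAB; lia.
rewrite cardsX natrM card_supsets_of_card // (bin_sub_prod R le_ABm le_mn) cAB.
rewrite (card_rainbow_pair R A B q_gt0) cA cBA card_colored_subsets natrM.
rewrite -/g; ring.
Qed.

Lemma card_rainbow_in (A : {set X}) : A \in H ->
  #|[set w in colored_subsets X q m | rainbow_in w A]|%:R
  = #|colored_subsets X q m|%:R * (\prod_(i < r) g i * \prod_(i < r) h i).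
Proof.
move=> HA; have := card_rainbow_in_pair HA HA.
rewrite setIid (unifH HA) subnn addn0 big_ord0 mulr1 mulrA => <-.
by congr (_%:R); apply: eq_card => w; rewrite !inE andbb.
Qed.

(** Each vertex shared by two edges costs at most a factor [x], the inverse of [b * d], in their
    joint probability. What remains is to bound the overlaps weighted by powers of [x]. *)
Lemma rainbow_edge_prob (b d x eps : R) : H != set0 ->
    0 < b -> 0 < d -> (b * d) * x = 1 ->
    (forall i, (i < r + r)%N -> b <= g i) ->
    (forall i, (i < r)%N -> d <= h i) ->
    (forall A, A \in H -> \sum_(B in H) x ^+ #|B :&: A| <= (1 + eps) * #|H|%:R) ->
  1 - eps <= unif_prob R (colored_subsets X q m) (@has_rainbow_edge X H q).
Proof.
move=> H_n0 b_gt0 d_gt0 bdx b_le d_le sum_le.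
set Omega := colored_subsets X q m.
set G := \prod_(i < r) g i; set D := \prod_(i < r) h i.
have x_gt0 : 0 < x by rewrite -(pmulr_rgt0 _ (mulr_gt0 b_gt0 d_gt0)) bdx.
have G_gt0 : 0 < G.
  by apply: prodr_gt0 => i _; apply: (lt_le_trans b_gt0); apply: b_le; have := ltn_ord i; lia.
have D_gt0 : 0 < D by apply: prodr_gt0 => i _; apply: (lt_le_trans d_gt0); apply: d_le.
have H_gt0 : 0 < #|H|%:R :> R by rewrite ltr0n card_gt0.
have g_anti i j : (i <= j < r + r)%N -> g j <= g i.
  move=> /andP[le_ij lt_jr]; rewrite /g.
  rewrite ler_pdivrMr ?ltr0n; last by lia.
  rewrite mulrAC ler_pdivlMr ?ltr0n; last by lia.
  rewrite -!natrM ler_nat.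
  (* After cross-multiplication and cancelling the common product, [m - j <= #|X| - j] remains, up
     to the factor [j - i]. *)
  have -> : (#|X| - i = (#|X| - j) + (j - i))%N by lia.
  have -> : (m - i = (m - j) + (j - i))%N by lia.
  rewrite mulnDr mulnDl leq_add2l mulnC leq_mul2l; apply/orP; right.
  exact: leq_sub2r.
have pair_le A B : A \in H -> B \in H ->
    #|[set w in Omega | rainbow_in w A && rainbow_in w B]|%:R
    <= #|Omega|%:R * (G * D) ^+ 2 * x ^+ #|B :&: A|.
  move=> HA HB; rewrite card_rainbow_in_pair // -/Omega -/D.
  set t := #|B :&: A|.
  have le_tr : (t <= r)%N by rewrite -(unifH HA) subset_leq_card ?subsetIr.
  have gle := prod_overlap_antitone (ltW b_gt0) le_tr b_le g_anti.
  have hle := prod_overlap_shift (ltW d_gt0) le_tr d_le.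
  rewrite -/G -/D in gle hle.
  set PG := \prod_(i < r + (r - t)) g i in gle *.
  set PD := D * _ in hle *.
  have PG_ge0 : 0 <= PG.
    apply: prodr_ge0 => i _; apply: le_trans (ltW b_gt0) (b_le i _).
    by apply: leq_trans (ltn_ord i) _; rewrite leq_add2l leq_subr.
  have PD_ge0 : 0 <= PD.
    apply: mulr_ge0 (ltW D_gt0) _; apply: prodr_ge0 => i _.
    by apply: le_trans (ltW d_gt0) (d_le _ _); rewrite -ltn_subRL.
  rewrite -[leLHS]mulrA -[leRHS]mulrA; apply: ler_wpM2l => //.
  (* Insert [(b * d * x) ^+ t = 1], so that [b ^+ t] and [d ^+ t] are absorbed by the two overlap
     bounds. *)
  have -> : PG * PD = (b ^+ t * PG) * (d ^+ t * PD) * x ^+ t.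
    rewrite -[LHS]mul1r -(expr1n _ t) -bdx !exprMn; ring.
  rewrite exprMn; apply: ler_wpM2r; first by rewrite exprn_ge0 ?ltW.
  by apply: ler_pM => //; apply: mulr_ge0 => //; apply: exprn_ge0; apply: ltW.
apply: (@second_moment R _ _
  (fun w => \sum_(A in H) (rainbow_in w A)%:R) _ (#|H|%:R * (G * D))).
- move=> w; rewrite /has_rainbow_edge negb_exists => /forallP noE.
  rewrite big1 // => A HA; have := noE A; rewrite HA /= /rainbow_in.
  by move=> /negbTE ->.
- by rewrite !mulr_gt0.
- by rewrite -card_gt0 card_colored_subsets muln_gt0 bin_gt0 le_mn expn_gt0 q_gt0.
- rewrite exchange_big /= (eq_bigr (fun _ => #|Omega|%:R * (G * D))).
    by rewrite sumr_const -[LHS]mulr_natl; ring.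
  by move=> A HA; rewrite -natr_card_pred card_rainbow_in.
- have -> : \sum_(w in Omega) (\sum_(A in H) (rainbow_in w A)%:R) ^+ 2
      = \sum_(A in H) \sum_(B in H)
          #|[set w in Omega | rainbow_in w A && rainbow_in w B]|%:R :> R.
    under eq_bigr => w _ do rewrite expr2 big_distrlr /=.
    rewrite exchange_big /=; apply: eq_bigr => A _.
    rewrite exchange_big /=; apply: eq_bigr => B _.
    by rewrite natr_card_pred; apply: eq_bigr => w _; rewrite -natrM mulnb.
  have -> : (1 + eps) * (#|H|%:R * (G * D)) ^+ 2 * #|Omega|%:R
      = \sum_(A in H) (#|Omega|%:R * (G * D) ^+ 2 * ((1 + eps) * #|H|%:R)).
    by rewrite sumr_const -[RHS]mulr_natl; ring.
  apply: ler_sum => A HA.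
  have c_ge0 : 0 <= #|Omega|%:R * (G * D) ^+ 2 by rewrite mulr_ge0 ?sqr_ge0.
  apply: le_trans (ler_wpM2l c_ge0 (sum_le A HA)); rewrite mulr_sumr.
  by apply: ler_sum => B HB; apply: pair_le.
Qed.

End SecondMoment.

(** * Overlap profile of an edge, and choice of the constants *)

Lemma sum_inter_count (R : realType) (X : finType) (H : {set {set X}})
    (A : {set X}) (x : R) :
  \sum_(B in H) x ^+ #|B :&: A| = \sum_(t < #|A|.+1) (inter_count H t A)%:R * x ^+ t.
Proof.
have lt_A (B : {set X}) : (#|B :&: A| < #|A|.+1)%N.
  by rewrite ltnS subset_leq_card ?subsetIr.
rewrite (partition_big (fun B => Ordinal (lt_A B)) xpredT) //=.
apply: eq_bigr => t _; rewrite /inter_count mulr_natl -sumr_const.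
apply: eq_big => [B | B /andP[_ /eqP <-]] //.
by rewrite inE -val_eqE.
Qed.

Theorem theorem3 (R : realType) (alpha K0 : R)
    (alpha_gt0 : 0 < alpha) (alpha_lt1 : alpha < 1) (K0_gt0 : 0 < K0)
    (eps eps1 : R) (eps_gt0 : 0 < eps) (eps1_gt0 : 0 < eps1) :
  exists C : R, exists (r0 : nat) (kappa0 : R),
    forall (r : nat) (kappa : R), (r0 <= r)%N -> kappa0 <= kappa ->
    forall (X : finType) (H : {set {set X}}),
      H != set0 ->
      spread kappa H ->
      uniform r H ->
      edge_transitive H ->
      (forall A : {set X}, A \in H ->
       forall t : nat, (1 <= t)%N -> t%:R <= alpha * r%:R ->
         (inter_count H t A)%:R <= (K0 / kappa) ^+ t * #|H|%:R) ->
    forall q : nat, (1 + eps1) * r%:R <= q%:R ->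
    forall m : nat, (m <= #|X|)%N -> C * #|X|%:R / kappa <= m%:R ->
      1 - eps <= unif_prob R (colored_subsets X q m) (@has_rainbow_edge X H q).
Proof.
(* [d] bounds from below the chance of a new colour; [y] is the ratio of the final geometric
   series. *)
pose d := eps1 / (1 + eps1); pose y := eps / (1 + eps).
(* Since [N] exceeds [alpha^-1], any [t > alpha * r] satisfies [r <= N * t], so
   [2 ^+ r <= (2 ^+ N) ^+ t]. [K1] thus serves both ranges of [t]. *)
pose N := Num.bound alpha^-1; pose K1 := K0 + 2 ^+ N.
have d_gt0 : 0 < d by rewrite divr_gt0 // addr_gt0.
have y_gt0 : 0 < y by rewrite divr_gt0 // addr_gt0.
have dE : d = eps1 / (1 + eps1) by [].
have yE : y = eps / (1 + eps) by [].
clearbody d y.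
have N_gt : alpha^-1 < N%:R by apply: archi_boundP; rewrite invr_ge0 ltW.
have K1_gt0 : 0 < K1 by rewrite addr_gt0 ?exprn_gt0.
(* The summand [4] yields [4 * r <= m]; the other one yields [x * (K1 / kappa) <= y]. *)
pose C := 4 + 2 * K1 / (d * y).
have C_ge : 2 * K1 / (d * y) <= C by rewrite /C lerDr.
have C_ge4 : 4 <= C by rewrite /C lerDl; apply/ltW/divr_gt0; apply: mulr_gt0.
exists C, 1%N, 1 => r kappa r_gt0 kappa_ge1 X H H_n0 spreadH unifH _ fH.
move=> q le_rq m le_mn le_Cm.
have kappa_gt0 : 0 < kappa by apply: lt_le_trans kappa_ge1.
have r_gt0R : 0 < r%:R :> R by rewrite ltr0n.
have q_gt0R : 0 < q%:R :> R by apply: lt_le_trans le_rq; rewrite mulr_gt0 ?addr_gt0.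
have q_gt0 : (0 < q)%N by rewrite -(ltr0n R).
have le_rn := spread_uniform_card kappa_gt0 spreadH H_n0 unifH.
have n_gt0R : 0 < #|X|%:R :> R by apply: lt_le_trans le_rn; rewrite mulr_gt0.
(* Here [r <= #|X| / kappa], by double counting. *)
have le_Crm : C * r%:R <= m%:R.
  apply: le_trans le_Cm; rewrite -mulrA; apply: ler_wpM2l; first exact: le_trans C_ge4.
  by rewrite ler_pdivlMr // mulrC.
have le_4rm : (4 * r <= m)%N.
  rewrite -(ler_nat R) natrM; apply: le_trans le_Crm; by apply: ler_wpM2r C_ge4; apply: ltW.
have m_gt0R : 0 < m%:R :> R by rewrite ltr0n; clear - r_gt0 le_4rm; lia.
(* [b] is half the density of the random subset, and [x] is the inverse of [b * d]. *)
pose b : R := m%:R / (2 * #|X|%:R); pose x : R := 2 * #|X|%:R / (m%:R * d).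
have x_gt0 : 0 < x by rewrite divr_gt0 ?mulr_gt0.
have xK : x * (K1 / kappa) <= y.
  have -> : x * (K1 / kappa) = (2 * K1 / d) * (#|X|%:R / kappa) / m%:R.
    by rewrite /x; field; rewrite !gt_eqF.
  rewrite ler_pdivrMr //; apply: le_trans (ler_wpM2l (ltW y_gt0) le_Cm).
  rewrite -[C * _ / _]mulrA [leRHS]mulrA; apply: ler_wpM2r; first by rewrite divr_ge0 ?ltW.
  apply: le_trans (ler_wpM2l (ltW y_gt0) C_ge).
  by rewrite le_eqVlt; apply/orP; left; apply/eqP; field; rewrite !gt_eqF.
have f_le A t : A \in H -> (1 <= t <= r)%N ->
    (inter_count H t A)%:R <= (K1 / kappa) ^+ t * #|H|%:R.
  move=> HA /andP[t_gt0 le_tr]; have [le_ta | lt_at] := leP t%:R (alpha * r%:R).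
    apply: le_trans (fH A HA t t_gt0 le_ta) _; apply: ler_wpM2r => //.
    apply: lerXn2r; rewrite ?nnegrE ?divr_ge0 ?(ltW K0_gt0) ?(ltW K1_gt0) ?(ltW kappa_gt0) //.
    by rewrite ler_wpM2r ?invr_ge0 ?(ltW kappa_gt0) // /K1 lerDl exprn_ge0.
  apply: le_trans (inter_count_le_spread kappa_gt0 spreadH t A) _.
  rewrite (unifH A HA) expr_div_n mulrA mulrAC; apply: ler_wpM2r => //.
  apply: ler_wpM2r; first by rewrite invr_ge0 exprn_ge0 ?ltW.
  have le_rNt : (r <= N * t)%N.
    rewrite -(ler_nat R) natrM; have rE : r%:R = alpha^-1 * (alpha * r%:R).
      by rewrite mulrA mulVf ?mul1r ?gt_eqF.
    rewrite rE; apply: ler_pM; rewrite ?invr_ge0 ?mulr_ge0 ?(ltW alpha_gt0) //; exact: ltW.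
  apply: (@le_trans _ _ ((2 ^+ N) ^+ t)).
    by rewrite -exprM ler_weXn2l // ler1n.
  by apply: lerXn2r; rewrite ?nnegrE ?exprn_ge0 ?(ltW K1_gt0) // /K1 lerDr ltW.
apply: (@rainbow_edge_prob R X H r q m unifH q_gt0 _ le_mn b d x) => //.
- by clear - le_4rm; lia.
- by rewrite divr_gt0 ?mulr_gt0.
- by rewrite /b /x; field; rewrite !gt_eqF.
(* From [i < 2 * r] and [4 * r <= m], at least half of [m] remains; this is where the [2] in [b]
   comes from. *)
- move=> i lt_i2r; have ni_gt0 : (0 < #|X| - i)%N by clear - lt_i2r le_4rm le_mn; lia.
  rewrite /b ler_pdivrMr ?mulr_gt0 // mulrAC ler_pdivlMr ?ltr0n //.
  rewrite -!natrM ler_nat.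
  have : (m <= 2 * (m - i))%N by clear - lt_i2r le_4rm; lia.
  move=> le_m2; apply: leq_trans (leq_mul le_m2 (leq_subr i #|X|)) _.
  by rewrite -mulnA mulnCA mulnA.
(* As [i < r] and [q >= (1 + eps1) * r], the proportion of used colours is at most
   [1 / (1 + eps1) = 1 - d]. *)
- move=> i lt_ir; rewrite dE ler_pdivrMr ?addr_gt0 // mulrAC ler_pdivlMr //.
  have le_ir : i%:R <= r%:R :> R by rewrite ler_nat ltnW.
  have le_iq : (i <= q)%N.
    rewrite -(ler_nat R); apply: le_trans le_ir _; apply: le_trans le_rq.
    clear - eps1_gt0 r_gt0R; nra.
  rewrite natrB //; clear - le_ir le_rq eps1_gt0; nra.
- move=> A HA; rewrite sum_inter_count (unifH A HA).
  apply: le_trans (_ : \sum_(t < r.+1) y ^+ t * #|H|%:R <= _); last first.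
    by rewrite -mulr_suml yE ler_wpM2r // geometric_sum_le.
  apply: ler_sum => -[t lt_tr] _ /=.
  (* The bound [f_le] starts at [t = 1]; for [t = 0] the trivial bound [#|H|] is the leading term of
     the series. *)
  have [-> | t_gt0] := posnP t.
    rewrite !expr0 mulr1 mul1r ler_nat subset_leq_card //.
    by apply/subsetP => B; rewrite inE => /andP[].
  apply: le_trans (ler_wpM2r (exprn_ge0 _ (ltW x_gt0)) (f_le A t HA _)) _.
    by rewrite t_gt0 -ltnS.
  rewrite mulrAC; apply: ler_wpM2r => //; rewrite -exprMn mulrC.
  by apply: lerXn2r xK; rewrite nnegrE ltW //; apply: mulr_gt0 => //; apply: divr_gt0.
Qed.
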